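(* There is a weight set $\Omega(R^+)\subset V$ containing the half sum of positive roots $\varrho=\frac12\sum_{e\in R^+}e$ such that $$\Gamma(R^+)=\bigsqcup_{\alpha\in\Omega(R^+)}\Gamma(\alpha),$$ where each $\Gamma(\alpha)$ is a full subgraph (called weight subgraph) of $\Gamma(R^+)$ and $\sqcup$ means the disjoint union of graphs. The action $\circ$ of $W$ on $\Gamma(R^+)$ keeps the weight and graph structure, i.e., for any $w\in W$, the 1-1 correspondence $w\circ\colon\Gamma(R^+)\to\Gamma(R^+)$ is a graph isomorphism such that its restriction on $\Gamma(\alpha)$ is a graph isomorphism from $\Gamma(\alpha)$ to $\Gamma(w*\alpha)$ for all $\alpha\in\Omega(R^+)$.
   Context: $R^+$ is the positive root system of a semi-simple Lie algebra over $\mathbb C$, $V$ is the real vector space spanned by $R^+$, and $W$ is the Weyl group acting on $V$, the action of $w\in W$ on $v\in V$ being written $w*v$. For a subset $S\subset V$, $w*S=\{w*v\mid v\in S\}$. The basis graph $\Gamma(R^+)$ has as vertices all subsets of $R^+$ (including $\emptyset$); for two vertices $\sigma,\tau$, $\{\sigma,\tau\}$ is an edge if there are $e,e_1,e_2\in R^+$ with $e=e_1+e_2$ such that either $\sigma\setminus\tau=\{e\}$ and $\tau\setminus\sigma=\{e_1,e_2\}$, or $\tau\setminus\sigma=\{e\}$ and $\sigma\setminus\tau=\{e_1,e_2\}$. The same symbol denotes a graph and its vertex set. The action $\circ$ of $W$ on the vertex set of $\Gamma(R^+)$ is given by $w\circ\sigma=\big(w*(\sigma\cup-\sigma^c)\big)\cap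 R^+$, where $\sigma^c=R^+\setminus\sigma$. *)

(* Defs.v *)
From HB Require Import structures.
From mathcomp Require Import all_boot all_order all_algebra.
From mathcomp Require Import all_classical all_reals.

Set Implicit Arguments.
Unset Strict Implicit.
Unset Printing Implicit Defensive.

Import Order.TTheory GRing.Theory Num.Theory.
Local Open Scope classical_set_scope.
Local Open Scope ring_scope.

(** * Root systems

    Root systems of semi-simple complex Lie algebras, in Bourbaki's axiomatic
    form: finite, reduced, crystallographic, spanning the real space [V].  The
    linear form [coroot a] is the pairing of [V] with the coroot of [a]; on
    roots it is determined by the other fields, and its values at non-roots
    are irrelevant. *)
Record root_system (R : realType) (V : vectType R) := RootSystem {
  rootset : set V;
  coroot : V -> 'Hom(V, R^o);
  root_finite : finite_set rootset;
  root_span : forall U : {vspace V}, rootset `<=` [set` U] -> U = fullv;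
  root_neq0 : forall a, rootset a -> a != 0;
  coroot_self : forall a, rootset a -> coroot a a = 2;
  root_reflection : forall a b, rootset a -> rootset b -> rootset (b - coroot a b *: a);
  coroot_int : forall a b, rootset a -> rootset b -> coroot a b \is a Num.int;
  root_reduced : forall a (c : R), rootset a -> rootset (c *: a) -> c = 1 \/ c = -1
}.

Definition reflection (R : realType) (V : vectType R) (Phi : root_system V)
  (a : V) : 'End(V) := linfun (fun v => v - coroot Phi a v *: a).

(** The subgroup of GL(V) generated by the reflections in the roots. *)
Inductive weyl_group (R : realType) (V : vectType R) (Phi : root_system V) :
    'End(V) -> Prop :=
| weyl_refl a of rootset Phi a : weyl_group Phi (reflection Phi a)
| weyl_one : weyl_group Phi \1%VF
| weyl_mul w1 w2 of weyl_group Phi w1 & weyl_group Phi w2 :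
    weyl_group Phi (w1 \o w2)%VF
| weyl_inv w of weyl_group Phi w : weyl_group Phi (w^-1)%VF.

(** A choice of positive roots: the roots lying strictly on one side of a
    hyperplane that contains no root. *)
Definition positive_system (R : realType) (V : vectType R)
    (Phi : root_system V) (Rp : set V) : Prop :=
  exists t : 'Hom(V, R^o),
    (forall a, rootset Phi a -> t a != 0) /\ Rp = [set a | rootset Phi a /\ 0 < t a].

(** * Simple graphs on sets of vertices *)

Record graph (T : Type) := Graph {
  vert : set T;
  adj : T -> T -> Prop;
  adj_vert : forall x y, adj x y -> vert x /\ vert y;
  adj_sym : forall x y, adj x y -> adj y x;
  adj_irr : forall x, ~ adj x x
}.

Definition full_subgraph (T : Type) (H G : graph T) : Prop :=
  vert H `<=` vert G /\
  forall x y, vert H x -> vert H y -> (adj H x y <-> adj G x y).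

Definition disjoint_union_of (T I : Type) (G : graph T) (D : set I)
    (F : I -> graph T) : Prop :=
  [/\ vert G = \bigcup_(i in D) vert (F i),
      (forall i j, D i -> D j -> i <> j -> vert (F i) `&` vert (F j) = set0) &
      forall x y, adj G x y <-> exists2 i, D i & adj (F i) x y].

Definition graph_iso (T U : Type) (G : graph T) (H : graph U) (f : T -> U) :
    Prop :=
  set_bij (vert G) (vert H) f /\
  forall x y, vert G x -> vert G y -> (adj G x y <-> adj H (f x) (f y)).

(** * The basis graph *)

Section BasisGraph.
Variables (R : realType) (V : vectType R) (Rp : set V).

Definition basis_edge (s t : set V) : Prop :=
  [/\ s `<=` Rp, t `<=` Rp &
    exists e e1 e2, [/\ Rp e, Rp e1, Rp e2, e = e1 + e2 &
      (s `\` t = [set e] /\ t `\` s = [set e1; e2]) \/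
      (t `\` s = [set e] /\ s `\` t = [set e1; e2])]].

Lemma basis_edge_vert s t :
  basis_edge s t -> [set u | u `<=` Rp] s /\ [set u | u `<=` Rp] t.
Proof. by case. Qed.

Lemma basis_edge_sym s t : basis_edge s t -> basis_edge t s.
Proof.
case=> hs ht [e [e1 [e2 [he he1 he2 hE h]]]]; split=> //.
by exists e, e1, e2; split=> //; case: h; [right | left].
Qed.

Lemma basis_edge_irr s : ~ basis_edge s s.
Proof.
case=> _ _ [e [e1 [e2 [_ _ _ _]]]]; rewrite setDv.
by case=> -[h _]; have : [set e] e by []; rewrite -h.
Qed.

Definition basis_graph : graph (set V) :=
  Graph basis_edge_vert basis_edge_sym basis_edge_irr.

(** [s] together with the negatives of its complement in the positive roots *)
Definition signed_set (s : set V) : set V := s `|` -%R @` (Rp `\` s).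

Definition circ (w : 'End(V)) (s : set V) : set V := (w @` signed_set s) `&` Rp.

Definition half_sum : V := 2^-1 *: \sum_(e \in Rp) e.

(** The weight of a vertex, normalised so that the full set of positive roots
    has weight [half_sum]; it equals (sum of [s]) - [half_sum]. *)
Definition weight (s : set V) : V := 2^-1 *: \sum_(e \in signed_set s) e.

End BasisGraph.

(* Main.v *)
Require Import Defs.
From HB Require Import structures.
From mathcomp Require Import all_boot all_order all_algebra.
From mathcomp Require Import all_classical all_reals.
From mathcomp Require Import lra.

Import Order.TTheory GRing.Theory Num.Theory.
Local Open Scope classical_set_scope.
Local Open Scope ring_scope.

Set Implicit Arguments.
Unset Strict Implicit.
Unset Printing Implicit Defensive.

(** A vertex [s] is the same thing as its signed set, a subset of the root
    system containing exactly one root of each pair [a, -a]; [circ w] is then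
    simply the image under [w].  In these terms [s] and [t] are adjacent iff
    the difference of their signed sets consists of three roots with sum [0],
    a condition which is visibly invariant under linear automorphisms of the
    root system.  Weights are sums over signed sets: they are equivariant, and
    constant along edges because the three roots that change sign add up to
    [0]. *)

(** * Linear automorphisms of the root system *)

(** Collects what the proof uses of a Weyl group element; as [V] has finite dimension, a trivial
    kernel makes [w] invertible. *)
Definition root_automorphism (R : realType) (V : vectType R)
    (Phi : root_system V) (w : 'End(V)) : Prop :=
  lker w == 0%VS /\ forall v, rootset Phi (w v) <-> rootset Phi v.

Section RootSystem.
Variables (R : realType) (V : vectType R) (Phi : root_system V).
Implicit Types (a b v : V) (w : 'End(V)).

Lemma rootN a : rootset Phi a -> rootset Phi (- a).
Proof.
move=> ha; have := root_reflection ha ha.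
by rewrite coroot_self// scaler_nat mulr2n opprD addNKr.
Qed.

Lemma reflectionE a v : reflection Phi a v = v - coroot Phi a v *: a.
Proof.
pose f u := u - coroot Phi a u *: a.
have f_lin : linear f.
  move=> k x y; rewrite /f linearP scalerDl scalerBr opprD addrACA; congr (_ + _).
  by rewrite scalerA.
(* [linfun] is known to agree with its argument only when that carries a linear structure, so one is
   attached to [f]. *)
pose L := GRing.isLinear.Build _ _ _ _ f f_lin.
pose g : {linear V -> V} := HB.pack f L.
exact: (lfunE g v).
Qed.

Lemma reflectionK a : rootset Phi a -> involutive (reflection Phi a).
Proof.
move=> ha v; rewrite !reflectionE; set k := coroot Phi a v.
have -> : coroot Phi a (v - k *: a) = - k.
  by rewrite linearB linearZ /= coroot_self// -/k /GRing.scale /=; lra.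
by rewrite scaleNr opprK subrK.
Qed.

Lemma weyl_group_root_automorphism w :
  weyl_group Phi w -> root_automorphism Phi w.
Proof.
elim=> {w} [a ha||w1 w2 _ [k1 r1] _ [k2 r2]|w _ [k r]].
- split; first by apply/lker0P; exact: can_inj (reflectionK ha).
  have h v : rootset Phi v -> rootset Phi (reflection Phi a v).
    by move=> hv; rewrite reflectionE; exact: root_reflection.
  by move=> v; split=> [/h|/h//]; rewrite reflectionK.
- by split=> [|v]; [apply/lker0P => x y; rewrite !id_lfunE | rewrite id_lfunE].
- split=> [|v]; last by rewrite comp_lfunE r1 r2.
  by apply/lker0P => x y; rewrite !comp_lfunE => /(lker0P k1)/(lker0P k2).
- split=> [|v]; last by rewrite -{2}(lker0_lfunVK k v) r.
  by apply/lker0P; exact: can_inj (lker0_lfunVK k).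
Qed.

Lemma root_automorphism_inv w :
  root_automorphism Phi w -> root_automorphism Phi (w^-1)%VF.
Proof.
case=> k r; split=> [|v]; last by rewrite -{2}(lker0_lfunVK k v) r.
by apply/lker0P; exact: can_inj (lker0_lfunVK k).
Qed.

End RootSystem.

Lemma linear_fsum (R : realType) (V : vectType R) (w : 'End(V)) (A : set V) :
  finite_set A -> w (\sum_(e \in A) e) = \sum_(e \in A) w e.
Proof. by move=> fA; rewrite !fsbig_finite// linear_sum. Qed.

(** * Positive roots and signed sets *)

Section PositiveSystem.
Variables (R : realType) (V : vectType R) (Phi : root_system V) (Rp : set V).
Hypothesis hRp : positive_system Phi Rp.
Implicit Types (a b c v : V) (s t : set V) (w : 'End(V)).

Lemma pos_root a : Rp a -> rootset Phi a.
Proof. by case: hRp => t [_ ->] []. Qed.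

Lemma pos_or_neg a : rootset Phi a -> Rp a \/ Rp (- a).
Proof.
case: hRp => t [ht ->] ha; have := ht a ha; rewrite neq_lt => /orP[h|h].
  by right; split; [exact: rootN | rewrite linearN oppr_gt0].
by left.
Qed.

Lemma pos_neg a : Rp a -> ~ Rp (- a).
Proof.
case: hRp => t [_ ->] [_ h] [_]; rewrite linearN oppr_gt0 => h'.
by have := lt_trans h h'; rewrite ltxx.
Qed.

(** The form that defines [Rp] is positive on the sum. This excludes triples of a single sign in
    [basis_edgeP]. *)
Lemma pos_sum3_neq0 a b c : Rp a -> Rp b -> Rp c -> a + b + c <> 0.
Proof.
case: hRp => t [_ ->] [_ ha] [_ hb] [_ hc] /(congr1 t).
rewrite !linearD linear0 => h; have := addr_gt0 (addr_gt0 ha hb) hc.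
by rewrite h ltxx.
Qed.

Lemma signed_setE s a :
  signed_set Rp s a <-> s a \/ (Rp (- a) /\ ~ s (- a)).
Proof.
split=> [[?|[x [h1 h2] <-]]|[?|[h1 h2]]]; first by left.
- by right; rewrite opprK.
- by left.
- by right; exists (- a) => //; rewrite opprK.
Qed.

Lemma signed_set_root s a :
  s `<=` Rp -> signed_set Rp s a -> rootset Phi a.
Proof.
move=> sR /signed_setE[/sR/pos_root//|[/pos_root/rootN]].
by rewrite opprK.
Qed.

Lemma signed_set_pos s a : Rp a -> signed_set Rp s a <-> s a.
Proof.
move=> ha; split=> [/signed_setE[//|[/(pos_neg ha)//]]|h].
by apply/signed_setE; left.
Qed.

Lemma signed_setI s : s `<=` Rp -> signed_set Rp s `&` Rp = s.
Proof.
move=> sR; apply/seteqP; split=> [a [h ha]|a h]; first exact/(signed_set_pos s ha).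
by split; [apply/signed_set_pos; auto | exact: sR].
Qed.

Lemma signed_setN s a : s `<=` Rp -> rootset Phi a ->
  (* It suffices to treat positive roots: for negative [a], the claim at [- a] yields the one at [a]
     by classical logic. *)
  signed_set Rp s (- a) <-> ~ signed_set Rp s a.
Proof.
move=> sR; suff H b : Rp b -> signed_set Rp s (- b) <-> ~ signed_set Rp s b.
  move=> /pos_or_neg[/H//|/[dup] ha /H]; rewrite opprK => h.
  split=> [h1 /h h2//|h1].
  by apply: contrapT => /h.
move=> hb; rewrite signed_setE opprK (signed_set_pos s hb).
by split=> [[/sR/(pos_neg hb)//|[]//]|h]; right.
Qed.

(** A set of roots holding exactly one of each pair [a], [- a] is determined by its positive
    members. This recognises signed sets. *)
Lemma signed_set_half (T : set V) :
    T `<=` rootset Phi ->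
    (forall a, rootset Phi a -> T (- a) <-> ~ T a) ->
  signed_set Rp (T `&` Rp) = T.
Proof.
move=> TP TN; apply/seteqP; split=> a.
  move=> /signed_setE[[]//|[h1 h2]]; have h3 := pos_root h1.
  by have := TN _ h3; rewrite opprK => -> h4; apply: h2.
move=> Ta; have ra := TP _ Ta; apply/signed_setE.
case: (pos_or_neg ra) => h; first by left.
by right; split=> // -[h1 _]; apply/(TN _ ra): Ta.
Qed.

Lemma circ_sub w s : circ Rp w s `<=` Rp.
Proof. by move=> a []. Qed.

(** The image under [w] again holds exactly one root of each opposite pair, so the restriction to
    [Rp] in [circ] loses no information. *)
Lemma signed_set_circ w s : root_automorphism Phi w -> s `<=` Rp ->
  signed_set Rp (circ Rp w s) = w @` signed_set Rp s.
Proof.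
move=> [k r] sR; apply: signed_set_half => [_ [a h <-]|a].
  by rewrite r; exact: signed_set_root h.
rewrite -{1 2 3}(lker0_lfunVK k a) => /r; set b := (w^-1)%VF a => hb.
have im v : (w @` signed_set Rp s) (w v) <-> signed_set Rp s v.
  by split=> [[u hu /(lker0P k) <-]//|h]; exists v.
by rewrite -linearN !im; exact: signed_setN.
Qed.

Lemma circK w w' s : root_automorphism Phi w -> s `<=` Rp -> cancel w w' ->
  circ Rp w' (circ Rp w s) = s.
Proof.
move=> hw sR wK; rewrite {1}/circ signed_set_circ// image_comp.
rewrite (_ : _ @` _ = signed_set Rp s) ?signed_setI//.
by rewrite -[RHS]image_id; apply: eq_imagel => x _ /=; rewrite wK.
Qed.

(** * Edges in terms of signed sets *)

(** Each signed set contains exactly one of [a], [- a], so passing from one set to the other flips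
    the sign of every root on which they differ. *)
Lemma signed_setDN s t a : s `<=` Rp -> t `<=` Rp ->
  (signed_set Rp t `\` signed_set Rp s) a <->
  (signed_set Rp s `\` signed_set Rp t) (- a).
Proof.
move=> sR tR; split=> [] [h1 h2].
  have ra := signed_set_root tR h1.
  by split; [exact/signed_setN | move/(signed_setN tR ra)].
have ra : rootset Phi a by rewrite -(opprK a); apply/rootN/(signed_set_root sR h1).
split; last exact/signed_setN.
by apply: contrapT => /(signed_setN tR ra).
Qed.

Lemma signed_setD_swap3 s t a b c : s `<=` Rp -> t `<=` Rp ->
    signed_set Rp s `\` signed_set Rp t = [set a; b; c] ->
  signed_set Rp t `\` signed_set Rp s = [set - a; - b; - c].
Proof.
move=> sR tR h; apply/seteqP; split=> x.
  move=> /(signed_setDN x sR tR); rewrite h => -[[/= e|/= e]|/= e].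
  - by left; left; rewrite /= -e opprK.
  - by left; right; rewrite /= -e opprK.
  - by right; rewrite /= -e opprK.
move=> hx; apply/(signed_setDN x sR tR); rewrite h.
case: hx => [[/= ->|/= ->]|/= ->]; rewrite opprK.
- by left; left.
- by left; right.
- by right.
Qed.

Lemma setD_pos s t : s `<=` Rp ->
  s `\` t = (signed_set Rp s `\` signed_set Rp t) `&` Rp.
Proof.
move=> sR; apply/seteqP; split=> [x [h1 h2]|x [[h1 h2] hx]].
  have hx := sR _ h1; split=> //; split; first exact/signed_set_pos.
  by move/(signed_set_pos t hx).
by split; [exact/(signed_set_pos s hx) | move/(signed_set_pos t hx)].
Qed.

(** The zero sum reads [a = - b - c] with [a], [- b], [- c] positive, so [s] trades [a] for [- b]
    and [- c]. *)
Lemma basis_edge_sign s t a b c : s `<=` Rp -> t `<=` Rp ->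
    a + b + c = 0 -> Rp a -> Rp (- b) -> Rp (- c) ->
    signed_set Rp s `\` signed_set Rp t = [set a; b; c] ->
  basis_edge Rp s t.
Proof.
move=> sR tR e0 ha hb hc h; split=> //; exists a, (- b), (- c); split=> //.
  by apply/eqP; rewrite -opprD -subr_eq0 opprK addrA e0.
left; rewrite (setD_pos t sR) (setD_pos s tR).
rewrite (signed_setD_swap3 sR tR h) h.
have nb := pos_neg hb; have nc := pos_neg hc; have na := pos_neg ha.
rewrite !opprK in nb nc.
split; apply/seteqP; split=> x.
- by case=> -[[/= -> //|/= ->]|/= ->].
- by move=> /= ->; split=> //; left; left.
- by case=> -[[/= -> //|/= -> _]|/= -> _]; [left|right].
- by case=> /= ->; split=> //; [left; right | right].
Qed.

(** Making no reference to signs, this form of adjacency can be transported by maps that do not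
    preserve [Rp]. *)
Lemma basis_edgeP s t : s `<=` Rp -> t `<=` Rp ->
  basis_edge Rp s t <->
  exists a b c, [/\ rootset Phi a, rootset Phi b, rootset Phi c, a + b + c = 0 &
    signed_set Rp s `\` signed_set Rp t = [set a; b; c]].
Proof.
move=> sR tR.
(* Positive members of the signed difference lie in [s'] but not [t']; negative ones are opposites
   of roots in [t'] but not [s']. *)
have fwd s' t' e e1 e2 : s' `<=` Rp -> t' `<=` Rp ->
    s' `\` t' = [set e] -> t' `\` s' = [set e1; e2] ->
    signed_set Rp s' `\` signed_set Rp t' = [set e; - e1; - e2].
  move=> sR' tR' st ts; apply/seteqP; split=> x.
    move=> hx; have [hx1 _] := hx.
    case: (pos_or_neg (signed_set_root sR' hx1)) => px.
      by left; left; rewrite -st setD_pos.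
    have : (t' `\` s') (- x).
      by rewrite setD_pos//; split=> //; apply/signed_setDN; rewrite ?opprK.
    rewrite ts => -[/= e'|/= e']; [left; right | right];
      by rewrite /= -e' opprK.
  have ts' y : [set e1; e2] y -> (signed_set Rp s' `\` signed_set Rp t') (- y).
    by rewrite -ts setD_pos// => -[/(signed_setDN y sR' tR')].
  case=> [[/= ->|/= ->]|/= ->].
  - have : [set e] e by [].
    by rewrite -st setD_pos// => -[].
  - by apply: ts'; left.
  - by apply: ts'; right.
split=> [[_ _ [e [e1 [e2 [he he1 he2 eE h]]]]]|].
  case: h => -[st ts].
    exists e, (- e1), (- e2); split=> //; try by [exact: pos_root | exact/rootN/pos_root].
      by rewrite eE -addrA -opprD subrr.
    exact: fwd.
  (* Here [fwd] applies with [s] and [t] exchanged; negating its triple restores the order. *)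
  exists (- e), e1, e2; split=> //; try by [exact: pos_root | exact/rootN/pos_root].
    by rewrite eE -addrA addNr.
  by rewrite (signed_setD_swap3 tR sR (fwd _ _ _ _ _ tR sR st ts)) !opprK.
case=> a [b [c [ra rb rc e0 h]]].
have h' := signed_setD_swap3 sR tR h.
have e0' : - a + - b + - c = 0 by rewrite -!opprD e0 oppr0.
have bac (x y z : V) : [set x; y; z] = [set y; x; z].
  by rewrite [[set x; y]]setUC.
have acb (x y z : V) : [set x; y; z] = [set x; z; y] by rewrite setUAC.
have bacD (x y z : V) : x + y + z = 0 -> y + x + z = 0 by rewrite (addrC y).
have acbD (x y z : V) : x + y + z = 0 -> x + z + y = 0 by rewrite addrAC.
have aE : Rp a = Rp (- - a) by rewrite opprK.
have bE : Rp b = Rp (- - b) by rewrite opprK.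
have cE : Rp c = Rp (- - c) by rewrite opprK.
(* Equal signs are impossible. With one positive root, [basis_edge_sign] applies after a
   permutation; with two, it applies to the negated triple with [s] and [t] exchanged. *)
case: (pos_or_neg ra) (pos_or_neg rb) (pos_or_neg rc)
  => pa [] pb [] pc.
- by case: (pos_sum3_neq0 pa pb pc).
- apply/basis_edge_sym/(@basis_edge_sign t s (- c) (- a) (- b)); rewrite -?aE -?bE //.
    exact/bacD/acbD.
  by rewrite bac acb.
- apply/basis_edge_sym/(@basis_edge_sign t s (- b) (- a) (- c)); rewrite -?aE -?cE //.
    exact/bacD.
  by rewrite bac.
- exact: (@basis_edge_sign s t a b c).
- apply/basis_edge_sym/(@basis_edge_sign t s (- a) (- b) (- c)); rewrite -?bE -?cE //.
- apply: (@basis_edge_sign s t b a c) => //; first exact/bacD.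
  by rewrite bac.
- apply: (@basis_edge_sign s t c a b) => //; first exact/bacD/acbD.
  by rewrite bac acb.
- by case: (pos_sum3_neq0 pa pb pc).
Qed.

Lemma basis_edge_circ w s t : root_automorphism Phi w ->
  basis_edge Rp s t -> basis_edge Rp (circ Rp w s) (circ Rp w t).
Proof.
move=> hw /[dup] -[sR tR _] /(basis_edgeP sR tR)[a [b [c [ra rb rc e0 h]]]].
have [k r] := hw.
apply/basis_edgeP; try exact: circ_sub.
exists (w a), (w b), (w c); split; try exact/r.
  by rewrite -!linearD e0 linear0.
rewrite !signed_set_circ//; transitivity (w @` [set a; b; c]); last first.
  by rewrite !image_setU !image_set1.
(* Images commute with set difference because [w] is injective. *)
rewrite -h; apply/seteqP; split=> [_ [[x hx <-] nx]|_ [x [hx nx] <-]].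
  by exists x => //; split=> // htx; apply: nx; exists x.
by split; [exists x | case=> y hy /(lker0P k) yx; rewrite yx in hy].
Qed.

(** * Weights of vertices *)

Lemma finite_signed_set s : s `<=` Rp -> finite_set (signed_set Rp s).
Proof.
move=> sR; apply: sub_finite_set (root_finite Phi) => a.
exact: signed_set_root.
Qed.

Lemma weight_circ w s : root_automorphism Phi w -> s `<=` Rp ->
  weight Rp (circ Rp w s) = w (weight Rp s).
Proof.
move=> hw sR; have [k _] := hw; rewrite /weight signed_set_circ// linearZ /=.
congr (_ *: _); rewrite linear_fsum; last exact: finite_signed_set.
by rewrite fsbig_image// => x y _ _; exact: (lker0P k).
Qed.

(** If [a = b], then [c] is [-2] times [a], which reducedness forbids. *)
Lemma root_sum3_neq a b c : rootset Phi a -> rootset Phi c ->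
  a + b + c = 0 -> a != b.
Proof.
move=> ra rc e0; apply/eqP => ab.
have cE : c = (-2) *: a.
  by apply/eqP; rewrite scaleNr -addr_eq0 scaler_nat mulr2n addrC {2}ab e0.
by rewrite cE in rc; have [] := root_reduced ra rc => {e0 ab cE} ?; lra.
Qed.

(** A sum over a set counts equal elements once, so the three roots must first be seen to be
    distinct. *)
Lemma sum_root3 a b c :
    rootset Phi a -> rootset Phi b -> rootset Phi c -> a + b + c = 0 ->
  \sum_(e \in [set a; b; c]) e = 0.
Proof.
move=> ra rb rc e0.
have ab := root_sum3_neq ra rc e0.
have ac : a != c by apply: (root_sum3_neq (b := c) ra rb); rewrite addrAC.
have bc : b != c.
  by apply: (root_sum3_neq (b := c) rb ra); rewrite addrC addrA.
rewrite !fsbigU//=; last 2 first.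
- by move=> x [/= -> /eqP]; rewrite (negbTE ab).
- by move=> x [[/= ->|/= ->] /eqP]; rewrite ?(negbTE ac) ?(negbTE bc).
by rewrite !fsbig_set1.
Qed.

Lemma weight_edge s t : basis_edge Rp s t -> weight Rp s = weight Rp t.
Proof.
move=> /[dup] -[sR tR _] /(basis_edgeP sR tR)[a [b [c [ra rb rc e0 h]]]].
have h' := signed_setD_swap3 sR tR h.
(* Both sums share the part over the intersection; the remaining parts run over triples with sum
   zero. *)
rewrite /weight (fsbigID (signed_set Rp t)); last exact: finite_signed_set.
rewrite [in RHS](fsbigID (signed_set Rp s)); last exact: finite_signed_set.
rewrite -!setDE h h' setIC; congr (_ *: (_ + _)).
rewrite sum_root3// sum_root3//; try exact: rootN.
by rewrite -!opprD e0 oppr0.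
Qed.

End PositiveSystem.

(** * Induced subgraphs *)

Section InducedSubgraph.
Variables (T : Type) (G : graph T) (P : set T).

Let iadj x y := [/\ P x, P y & adj G x y].

Lemma induced_adj_vert x y : iadj x y -> (vert G `&` P) x /\ (vert G `&` P) y.
Proof. by case=> px py h; have [] := adj_vert h. Qed.

Lemma induced_adj_sym x y : iadj x y -> iadj y x.
Proof. by case=> px py h; split=> //; exact: adj_sym. Qed.

Lemma induced_adj_irr x : ~ iadj x x.
Proof. by case=> _ _; exact: adj_irr. Qed.

Definition induced_subgraph : graph T :=
  Graph induced_adj_vert induced_adj_sym induced_adj_irr.

Lemma full_induced_subgraph : full_subgraph induced_subgraph G.
Proof.
by split=> [x []//|x y [_ px] [_ py]]; split=> [[]//|h]; split.
Qed.

End InducedSubgraph.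

(** * The weight decomposition and the Weyl group action *)

Theorem theorem2p4 (R : realType) (V : vectType R) (Phi : root_system V)
    (Rp : set V) (hRp : positive_system Phi Rp) :
  exists (Omega : set V) (Gamma : V -> graph (set V)),
    [/\ Omega (half_sum Rp),
        (forall alpha, Omega alpha ->
           [/\ full_subgraph (Gamma alpha) (basis_graph Rp),
               vert (Gamma alpha) =
                 [set s | vert (basis_graph Rp) s /\ weight Rp s = alpha] &
               vert (Gamma alpha) !=set0]),
        disjoint_union_of (basis_graph Rp) Omega Gamma &
        forall w : 'End(V), weyl_group Phi w ->
          graph_iso (basis_graph Rp) (basis_graph Rp) (circ Rp w) /\
          forall alpha, Omega alpha ->
            Omega (w alpha) /\
            graph_iso (Gamma alpha) (Gamma (w alpha)) (circ Rp w)].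
Proof.
(* The weight set consists of the weights attained by vertices, and each weight subgraph is induced
   on a fibre of [weight]. *)
exists (weight Rp @` [set s | s `<=` Rp]).
exists (fun alpha => induced_subgraph (basis_graph Rp) [set s | weight Rp s = alpha]).
split.
(* The vertex [Rp] has empty complement, so its weight is the half sum. *)
- exists Rp => //; rewrite /weight /half_sum /signed_set.
  by rewrite setDv image_set0 setU0.
- move=> _ [s sR <-]; split=> //; first exact: full_induced_subgraph.
  by exists s.
- split=> [|alpha beta _ _ ne|s t] /=.
  + apply/seteqP; split=> [s sR|s [alpha _ []//]].
    by exists (weight Rp s); [exists s | split].
  + by apply/seteqP; split=> // s [[_ /= e1] [_ /= e2]]; apply: ne; rewrite -e1.
  + split=> [st|[alpha _ []//]]; have [sR tR _] := st.
    (* Endpoints of an edge have equal weight, so the edge lies in a single fibre. *)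
    exists (weight Rp s); first by exists s.
    by split=> //=; rewrite (weight_edge hRp st).
move=> w /weyl_group_root_automorphism hw.
have hw' := root_automorphism_inv hw; have [k _] := hw.
have K1 s : s `<=` Rp -> circ Rp (w^-1)%VF (circ Rp w s) = s.
  by move=> sR; apply: (circK hRp hw sR) => v; exact: lker0_lfunK.
have K2 s : s `<=` Rp -> circ Rp w (circ Rp (w^-1)%VF s) = s.
  by move=> sR; apply: (circK hRp hw' sR) => v; exact: lker0_lfunVK.
have edgeE s t : s `<=` Rp -> t `<=` Rp ->
    basis_edge Rp s t <-> basis_edge Rp (circ Rp w s) (circ Rp w t).
  (* The converse is the forward implication for the inverse of [w], followed by cancellation. *)
  move=> sR tR; split=> [|/(basis_edge_circ hRp hw')]; last by rewrite !K1.
  exact: (basis_edge_circ hRp hw).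
have circ_inj s t : s `<=` Rp -> t `<=` Rp -> circ Rp w s = circ Rp w t -> s = t.
  by move=> sR tR /(congr1 (circ Rp (w^-1)%VF)); rewrite !K1.
split.
  split; last by move=> s t /= sR tR; exact: edgeE.
  split=> [s _|s t /set_mem sR /set_mem tR|s sR]; first exact: circ_sub.
    exact: circ_inj.
  by exists (circ Rp (w^-1)%VF s); [exact: circ_sub | exact: K2].
move=> _ [s0 s0R <-]; split.
  by exists (circ Rp w s0); [exact: circ_sub | exact: (weight_circ hRp)].
split.
  split=> [s [sR /= ws]|s t /set_mem[sR _] /set_mem[tR _]|s [sR /= ws]].
  - by split; [exact: circ_sub | rewrite /= (weight_circ hRp hw sR) ws].
  - exact: circ_inj.
  (* Equivariance for the inverse of [w] gives this preimage the weight of [s0]. *)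
  - exists (circ Rp (w^-1)%VF s); last exact: K2.
    split; first exact: circ_sub.
    by rewrite /= (weight_circ hRp hw' sR) ws lker0_lfunK.
move=> s t [/= sR ws] [tR wt]; split=> [[_ _ st]|[_ _ st]].
  split; rewrite /= ?(weight_circ hRp hw) ?ws ?wt//.
  exact/(edgeE s t sR tR).
by split=> //; apply/(edgeE s t sR tR).
Qed.
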